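(* Let $G$ be a graph and let $V_1,V_2,\ldots,V_k$ be independent sets of $G$ such that for all $i\neq j$, either $V_i\cap V_j=\emptyset$ or $V_i=V_j$. Then the set $$V_1V_2\cdots V_k=\{\{x_1,x_2,\ldots,x_k\} : x_i\in V_i \text{ for all } i,\ x_i\neq x_j \text{ for all } i\neq j\}$$ is an independent set of $T_k(G)$.
   Context: All graphs are finite and simple. For a graph $G$ with vertex set $V$ of size $n$ and $1\le k\le n-1$, the $k$-token graph $T_k(G)$ has as vertices the $k$-subsets of $V$, two of them adjacent if their symmetric difference is an edge of $G$. An independent set is a set of pairwise non-adjacent vertices. *)

(* Defs.v *)
From mathcomp Require Import all_boot.

Set Implicit Arguments.
Unset Strict Implicit.
Unset Printing Implicit Defensive.

Record sgraph := SGraph {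
  vertex :> finType;
  adj : rel vertex;
  adj_sym : symmetric adj;
  adj_irrefl : irreflexive adj }.

Definition edges (G : sgraph) : {set {set G}} :=
  [set E | [exists x : G, exists y : G, adj x y && (E == [set x; y])]].

Definition independent (G : sgraph) (S : {set G}) : Prop :=
  {in S &, forall x y, ~~ adj x y}.

Definition symdiff (T : finType) (A B : {set T}) : {set T} :=
  (A :\: B) :|: (B :\: A).

Definition ksubset (T : finType) (k : nat) : finType :=
  {A : {set T} | #|A| == k}.

Definition token_adj (G : sgraph) (k : nat) : rel (ksubset G k) :=
  fun A B => symdiff (val A) (val B) \in edges G.

Lemma token_adj_sym (G : sgraph) (k : nat) : symmetric (@token_adj G k).
Proof. by move=> A B; rewrite /token_adj /symdiff setUC. Qed.

Lemma token_adj_irrefl (G : sgraph) (k : nat) : irreflexive (@token_adj G k).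
Proof.
move=> A; rewrite /token_adj /symdiff setDv setU0; apply/negP; rewrite in_set.
case/existsP=> x /existsP[y /andP[_ /eqP E0]].
by have := set21 x y; rewrite -E0 inE.
Qed.

Definition token_graph (G : sgraph) (k : nat) : sgraph :=
  SGraph (@token_adj_sym G k) (@token_adj_irrefl G k).

Definition set_product (G : sgraph) (k : nat) (V : 'I_k -> {set G}) :
    {set token_graph G k} :=
  [set A : ksubset G k | [exists x : {ffun 'I_k -> G},
     [&& [forall i, x i \in V i],
         [forall i, forall j, (i != j) ==> (x i != x j)] &
         val A == [set x i | i : 'I_k]]]].

(* Main.v *)
Require Import Defs.
From mathcomp Require Import all_boot.

(** Every member [A] of the product meets the block [V i] in exactly as many
    points as there are indices [j] with [V j = V i].  Hence if two members
    differ only in [{x, y}], any block containing [x] must contain [y] as well,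
    so [x] and [y] are not adjacent. *)

Lemma symdiffC (T : finType) (A B : {set T}) : symdiff A B = symdiff B A.
Proof. by rewrite /symdiff setUC. Qed.

(** If [y] were outside [W], the traces of [A] and [B] on [W] would differ in the single point [x],
    so their sizes could not agree. *)
Lemma symdiff_pair_cardI (T : finType) (A B W : {set T}) (x y : T) :
  symdiff A B = [set x; y] -> #|A :&: W| = #|B :&: W| -> x \in W -> y \in W.
Proof.
move=> dAB cAB xW; apply/negPn/negP=> yW.
(* The hypotheses are symmetric in [A] and [B], and exactly one of the two sets contains [x]. *)
wlog /setDP[xA xB] : A B dAB cAB / x \in A :\: B.
  move=> IH; have := set21 x y; rewrite -dAB => /setUP[/(IH A B)|/(IH B A)].
    exact.
  by rewrite symdiffC; apply.
suff /proper_card : B :&: W \proper A :&: W by rewrite cAB ltnn.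
apply/properP; split; last by exists x; rewrite !inE ?xA ?xW ?(negPf xB).
(* A point [z] of [B :&: W] outside [A] would be [x], which is not in [B], or [y], which is not in
   [W]. *)
apply/subsetP=> z /setIP[zB zW]; rewrite inE zW andbT; apply: contraT => zA.
have : z \in symdiff A B by rewrite !inE zB zA orbT.
rewrite dAB => /set2P[] zE; first by rewrite -zE zB in xB.
by rewrite -zE zW in yW.
Qed.

Lemma set_productP (G : sgraph) (k : nat) (V : 'I_k -> {set G})
    (A : ksubset G k) :
  reflect (exists x : {ffun 'I_k -> G},
             [/\ forall i, x i \in V i, injective x & val A = [set x i | i : 'I_k]])
          (A \in set_product V).
Proof.
rewrite inE; apply: (iffP existsP) => -[x].
  case/and3P=> /forallP xV /forallP xI /eqP ->; exists x; split=> // i j xij.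
  apply/eqP; move/forallP/(_ j): (xI i); rewrite xij eqxx implybF.
  by rewrite negbK.
case=> xV xI ->; exists x; apply/and3P; split; first exact/forallP.
  by apply/forallP=> i; apply/forallP=> j; rewrite (inj_eq xI) implybb.
exact: eqxx.
Qed.

(** An injective choice [x] matches these indices with the points of [A] in [V i]: if [x j] is in
    [V i], then [V j] and [V i] share a point and so coincide. *)
Lemma card_set_product_block (G : sgraph) (k : nat) (V : 'I_k -> {set G})
    (hdisj : forall i j : 'I_k, i != j -> V i :&: V j = set0 \/ V i = V j)
    (A : ksubset G k) (i : 'I_k) :
  A \in set_product V -> #|val A :&: V i| = #|[set j | V j == V i]|.
Proof.
case/set_productP=> x [xV xI ->]; rewrite -(card_imset _ xI).
apply: eq_card => z; apply/setIP/imsetP=> [[/imsetP[j _ ->] xjV]|[j]].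
  exists j; rewrite // inE; have [->//|/hdisj[/setP/(_ (x j))|->//]] := eqVneq j i.
  by rewrite !inE xV xjV.
by rewrite inE => /eqP <- ->; split; [apply: imset_f|].
Qed.

Theorem theorem3p2 (G : sgraph) (k : nat) (hk : 1 <= k <= #|G| - 1)
  (V : 'I_k -> {set G})
  (hindep : forall i : 'I_k, independent (V i))
  (hdisj : forall i j : 'I_k, i != j -> V i :&: V j = set0 \/ V i = V j) :
  independent (set_product V).
Proof.
move=> A B AV BV; apply/negP; rewrite /= /token_adj inE.
case/existsP=> x /existsP[y /andP[xy /eqP dAB]].
(* Whichever of [A] and [B] contains [x], its elements were all chosen from blocks. *)
have [i xVi] : exists i, x \in V i.
  have := set21 x y; rewrite -dAB.
  case/setUP=> /setDP[xC _]; move: xC.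
    by case/set_productP: AV => f [fV _ ->] /imsetP[i _ ->]; exists i.
  by case/set_productP: BV => f [fV _ ->] /imsetP[i _ ->]; exists i.
have cAB : #|val A :&: V i| = #|val B :&: V i|.
  by rewrite !card_set_product_block.
have yVi := symdiff_pair_cardI _ _ _ _ _ _ dAB cAB xVi.
by have := hindep i _ _ xVi yVi; rewrite xy.
Qed.
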